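(* For $n\ge 1$, $a_n(13;1\to 2)=B_n$, the $n$-th Bell number.
   Context: Standard cycle form of $\sigma\in S_n$: product of disjoint cycles (fixed points included), each cycle starting with its largest element, cycles listed in increasing order of largest elements. The fundamental bijection $\theta:S_n\to S_n$ erases the parentheses of the standard cycle form to give a one-line permutation. For $\pi\in S_n$, $\hat\pi=\theta^{-1}(\pi)$. An arrow pattern $(\nu;H)$ of size $k$: a string $\nu=a_1\dots a_m$ of positive integers and a set $H$ of arrows $b\to c$, with all integers appearing forming $[k]$. $\pi\in S_n$ contains $(\nu;H)$ if there is $X=\{x_1<\dots<x_k\}\subseteq[n]$ with positions $t_1<\dots<t_m$ such that $\pi_{t_1}\cdots\pi_{t_m}=x_{a_1}\cdots x_{a_m}$ and $\hat\pi(x_b)=x_c$ for every arrow $b\to c\in H$; otherwise it avoids it. $a_n(\nu;H)$ = number of $\pi\in S_n$ avoiding $(\nu;H)$. $B_n$ is the number of set partitions of $[n]$. *)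

(* Defs.v *)
From mathcomp Require Import all_boot fingroup perm.

Set Implicit Arguments.
Unset Strict Implicit.
Unset Printing Implicit Defensive.

(* Permutations of [n] are elements of 'S_n, acting on 'I_n = {0, .., n-1};   *)
(* the integer i is the ordinal of value i - 1. The one-line word of   *)
(* pi is pi 0, pi 1, .., pi (n-1).                                            *)

Section FundamentalBijection.

Variable n : nat.
Implicit Types (s t : 'S_n) (x y : 'I_n).

Definition cycle_leader s : pred 'I_n :=
  fun x => all (fun y : 'I_n => y <= x) (orbit s x).

(* enum 'I_n is increasing, so cycles come in increasing order of leaders;    *)
(* orbit s x = [:: x; s x; s (s x); ...] is the cycle of x, started at x.     *)
Definition standard_cycle_form s : seq (seq 'I_n) :=
  [seq orbit s x | x <- enum 'I_n & cycle_leader s x].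

Definition theta_word s : seq 'I_n := flatten (standard_cycle_form s).

Lemma mem_theta_word s x : x \in theta_word s.
Proof.
pose m := [arg max_(y > x in orbit s x) (y : nat)].
have [xm m_max] : m \in orbit s x /\ forall y, y \in orbit s x -> y <= m.
  by rewrite /m; case: arg_maxnP; [exact: in_orbit | move=> i].
have mx y : (y \in orbit s m) = (y \in orbit s x).
  rewrite -!fconnect_orbit; apply: (same_connect (fconnect_sym perm_inj)).
  by rewrite (fconnect_sym perm_inj) fconnect_orbit.
apply/flatten_mapP; exists m; last by rewrite mx in_orbit.
rewrite mem_filter mem_enum andbT; apply/allP => y.
by rewrite mx => /m_max.
Qed.

Lemma theta_word_uniq s : uniq (theta_word s).
Proof.
rewrite /theta_word /standard_cycle_form.
have: all (cycle_leader s) [seq x <- enum 'I_n | cycle_leader s x].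
  exact: filter_all.
have: uniq [seq x <- enum 'I_n | cycle_leader s x].
  by rewrite filter_uniq ?enum_uniq.
elim: [seq x <- _ | _] => //= x r IHr /andP[xr ur] /andP[lx lr].
rewrite cat_uniq orbit_uniq IHr // andbT /=.
apply/hasPn => z /flatten_mapP[y yr zy]; apply/negP => zx.
have xy : fconnect s x y.
  apply: (@connect_trans _ _ z); first by rewrite fconnect_orbit.
  by rewrite (fconnect_sym perm_inj) fconnect_orbit.
have /allP/(_ y) := lx; rewrite -fconnect_orbit => /(_ xy) yx.
have /allP/(_ _ yr)/allP/(_ x) := lr.
rewrite -fconnect_orbit (fconnect_sym perm_inj) => /(_ xy) xy'.
by case/negP: xr; rewrite (_ : x = y) //; apply/val_inj/eqP; rewrite eqn_leq xy'.
Qed.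

Lemma size_theta_word s : size (theta_word s) == n.
Proof.
rewrite -(card_uniqP (theta_word_uniq s)) -[X in _ == X]card_ord.
by apply/eqP/eq_card => x; rewrite mem_theta_word.
Qed.

Definition theta_fun s (i : 'I_n) : 'I_n := tnth (Tuple (size_theta_word s)) i.

Lemma theta_fun_inj s : injective (theta_fun s).
Proof. by apply/(tuple_uniqP (Tuple (size_theta_word s)))/theta_word_uniq. Qed.

Definition theta s : 'S_n := perm (@theta_fun_inj s).

Lemma theta_one_line s : [seq theta s i | i <- enum 'I_n] = theta_word s.
Proof.
rewrite (eq_map (permE (@theta_fun_inj s))).
exact: (map_tnth_enum (Tuple (size_theta_word s))).
Qed.

Definition cycle_list_sorted (bs : seq (seq 'I_n)) :=
  [/\ all (fun b : seq 'I_n => size b != 0) bs,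
      all (fun b : seq 'I_n =>
             if b is x :: r then all (fun y : 'I_n => y < x) r else true) bs
    & pairwise (fun b c : seq 'I_n =>
             if (b, c) is (x :: _, y :: _) then x < y else true) bs].

Lemma standard_cycle_form_sorted s : cycle_list_sorted (standard_cycle_form s).
Proof.
rewrite /standard_cycle_form.
have orbE x : orbit s x = x :: behead (orbit s x).
  by rewrite /orbit -orderSpred.
split.
- by apply/allP => b /mapP[x _ ->]; rewrite orbE.
- apply/allP => b /mapP[x]; rewrite mem_filter => /andP[/allP lx _] ->.
  rewrite orbE; apply/allP => y yr.
  have := orbit_uniq s x; rewrite orbE /= => /andP[xr _].
  rewrite ltn_neqAle lx; last by rewrite orbE inE yr orbT.
  rewrite andbT.
  by apply/eqP => /val_inj exy; move: xr; rewrite -{1}exy yr.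
- rewrite pairwise_map.
  apply: (@sub_pairwise _ (relpre val ltn)).
    by move=> x y /=; rewrite (orbE x) (orbE y).
  apply: pairwise_filter; rewrite -pairwise_map val_enum_ord.
  by rewrite -sorted_pairwise ?iota_ltn_sorted //; exact: ltn_trans.
Qed.

Lemma flatten_sorted_inj bs cs :
  cycle_list_sorted bs -> cycle_list_sorted cs -> flatten bs = flatten cs ->
  bs = cs.
Proof.
elim: bs cs => [|b bs IHb] [|c cs] //.
- by move=> _ [] /=; case: c.
- by move=> [] /=; case: b.
case: b => [|x b] [] //= ne_b lt_b /andP[x_bs pw_b].
case: c => [|y c] [] //= ne_c lt_c /andP[y_cs pw_c] [exy]; subst y.
case/andP: lt_b => lt_b lt_bs; case/andP: lt_c => lt_c lt_cs.
have bad (u v : seq 'I_n) us vs : all (fun y : 'I_n => y < x) v ->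
    all (fun w : seq 'I_n => size w != 0) us ->
    all (fun w : seq 'I_n => if w is z :: _ then x < z else true) us ->
    u ++ flatten us = v ++ flatten vs -> size v <= size u.
  move=> lt_v ne_us x_us e; rewrite leqNgt; apply/negP => lt_uv.
  have := congr1 (fun w => nth x w (size u)) e.
  rewrite !nth_cat ltnn lt_uv subnn.
  case: us ne_us x_us e => [|[|z us0] us] //=.
    move=> _ _ /(congr1 size); rewrite !size_cat /= => e2 _.
    by move: lt_uv; rewrite -[size u]addn0 e2 ltnNge leq_addr.
  move=> _ /andP[xz _] _ ez.
  have /allP/(_ z) := lt_v; rewrite {1}ez mem_nth // => /(_ isT).
  by rewrite ltnNge (ltnW xz).
move=> e.
have size_bc : size b = size c.
  by apply/eqP; rewrite eqn_leq (bad _ _ _ _ lt_b ne_c y_cs (esym e))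
    (bad _ _ _ _ lt_c ne_b x_bs e).
have/eqP := e; rewrite eqseq_cat // => /andP[/eqP-> /eqP e'].
by rewrite (IHb cs).
Qed.

Lemma theta_inj : injective theta.
Proof.
move=> s t est.
have ew : theta_word s = theta_word t by rewrite -!theta_one_line est.
have ef := flatten_sorted_inj (standard_cycle_form_sorted s)
             (standard_cycle_form_sorted t) ew.
apply/permP => x; have /flatten_mapP[m ms xm] := mem_theta_word s x.
have : orbit s m \in standard_cycle_form t by rewrite -ef map_f.
case/mapP => m' _ eo.
rewrite -(nextE (cycle_orbit (@perm_inj _ s) m) xm).
by rewrite eo in xm *; rewrite (nextE (cycle_orbit (@perm_inj _ t) m') xm).
Qed.

Definition hat (pi : 'S_n) : 'S_n := invF theta_inj pi.

Lemma theta_hat pi : theta (hat pi) = pi.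
Proof. exact: f_invF. Qed.

Lemma hat_theta s : hat (theta s) = s.
Proof. exact: invF_f. Qed.

End FundamentalBijection.

(* A pattern (nu; H) of size k with nu of length m; (b, c) encodes b -> c.    *)
Record arrow_pattern (k m : nat) := ArrowPattern {
  pattern_word : m.-tuple 'I_k;
  pattern_arrows : {set 'I_k * 'I_k};
  pattern_letters : forall a : 'I_k,
    (a \in pattern_word) ||
    [exists b, ((a, b) \in pattern_arrows) || ((b, a) \in pattern_arrows)]
}.

Definition increasing k n (f : 'I_k -> 'I_n) : bool :=
  [forall i : 'I_k, forall j : 'I_k, (i < j) ==> (f i < f j)].

Definition contains n (pi : 'S_n) k m (p : arrow_pattern k m) : bool :=
  [exists x : {ffun 'I_k -> 'I_n}, exists t : {ffun 'I_m -> 'I_n},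
    [&& increasing x, increasing t,
        [forall i, pi (t i) == x (tnth (pattern_word p) i)]
      & [forall b, forall c,
          ((b, c) \in pattern_arrows p) ==> (hat pi (x b) == x c)]]].

Definition avoiders n k m (p : arrow_pattern k m) : {set 'S_n} :=
  [set pi : 'S_n | ~~ contains pi p].

Definition num_avoiders n k m (p : arrow_pattern k m) : nat := #|avoiders n p|.

Definition bell n : nat :=
  #|[set P : {set {set 'I_n}} | partition P [set: 'I_n]]|.

(* The integer i of [k+1] as a pattern letter.                                *)
Definition letter k (i : nat) : 'I_k.+1 := inord i.-1.

Definition word_13 : 2.-tuple 'I_3 := [tuple letter 2 1; letter 2 3].

Definition arrows_1to2 : {set 'I_3 * 'I_3} := [set (letter 2 1, letter 2 2)].

Fact pattern_13_1to2_letters (a : 'I_3) :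
  (a \in word_13) ||
  [exists b, ((a, b) \in arrows_1to2) || ((b, a) \in arrows_1to2)].
Proof.
have [->|->|->] : [\/ a = letter 2 1, a = letter 2 2 | a = letter 2 3].
  have aE : a = letter 2 a.+1 by rewrite /letter inord_val.
  by rewrite aE; case: a aE => -[|[|[|a]]] // lt_a _ /=;
    [constructor 1 | constructor 2 | constructor 3].
- by rewrite !inE eqxx.
- by apply/orP; right; apply/existsP; exists (letter 2 1); rewrite !inE eqxx orbT.
- by rewrite !inE eqxx orbT.
Qed.

Definition pattern_13_1to2 : arrow_pattern 3 2 :=
  ArrowPattern pattern_13_1to2_letters.

(* Main.v *)
(* Let m be the maximum and s the permutation with theta s = pi. Then pi      *)
(* avoids (13; 1 -> 2) exactly when every cycle of s but that of m is a fixed *)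
(* point and the cycle (m v_1 .. v_k) of m has v_1 .. v_k avoiding the        *)
(* vincular pattern 12-3. Hence the avoiders are counted by the sum over      *)
(* B, a subset of [n] minus m, of the number f(B) of 12-3-avoiding words on   *)
(* B. In such a word on A, what precedes max A is decreasing and what follows *)
(* is arbitrary, so f(A) is the sum of f(B) over the subsets B of A minus     *)
(* max A. Removing the block of max A gives set partitions the same           *)
(* recurrence.                                                                *)
Require Import Defs.
From mathcomp Require Import all_boot fingroup perm.

Set Implicit Arguments.
Unset Strict Implicit.
Unset Printing Implicit Defensive.

(** Since [theta] is a bijection, one may count the [s] with [theta s] avoiding. An occurrence is an
    ascent [x < s x] with a letter larger than [s x] somewhere to the right of [x]. The cycle of the
    maximum ends the word, so any nontrivial cycle elsewhere creates an occurrence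
    ([contains_theta]). The surviving [s] are coded by 12-3-avoiding words over the subsets [B] of
    [n] minus its maximum. By [size_words] there are as many words on [B] as partitions of [B], and
    summing over [B] is exactly [card_partitions_rec] at the maximum: the points off its cycle play
    the companions of the maximum in its block ([card_avoiding_cycles]). *)

(** * Recurrence for set partitions *)

Section SetPartitions.

Variable T : finType.
Implicit Types (A B : {set T}) (P Q : {set {set T}}).

Definition partitions A : {set {set {set T}}} := [set P | partition P A].

Lemma card_partitions0 : #|partitions set0| = 1.
Proof.
rewrite -(cards1 (set0 : {set {set T}})); apply: eq_card => P.
by rewrite !inE partition_set0.
Qed.

(** Partitions are sorted by the complement [B] of the block of [x]; putting the block [A :\: B]
    back inverts its removal. *)
Lemma card_partitions_rec A x : x \in A ->
  #|partitions A| = \sum_(B in powerset (A :\ x)) #|partitions B|.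
Proof.
move=> xA; rewrite -sum1_card.
rewrite (partition_big (fun P => A :\: pblock P x) (mem (powerset (A :\ x)))) /=.
  apply: eq_bigr => B; rewrite powersetE => sBA.
  have xB : x \notin B.
    by apply/negP => /(subsetP sBA); rewrite !inE eqxx.
  have sBA' : B \subset A := subset_trans sBA (subsetDl _ _).
  have xD : x \in A :\: B by rewrite inE xB.
  have DB : A :\: B :|: B = A.
    apply/setP => y; rewrite !inE; case: (boolP (y \in B)) => [yB|_] /=;
      last by rewrite orbF.
    by rewrite (subsetP sBA').
  have notQ Q : Q \in partitions B -> A :\: B \notin Q.
    rewrite inE => pQ; apply/negP => /(partitionS pQ)/subsetP/(_ x xD).
    by rewrite (negPf xB).
  have -> : #|partitions B| = #|[set (A :\: B) |: Q | Q in partitions B]|.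
    rewrite card_in_imset // => Q R /notQ nQ /notQ nR e.
    by rewrite -(setU1K nQ) e setU1K.
  rewrite -sum1_card; apply: eq_bigl => P; rewrite inE.
  apply/andP/imsetP => [[pP /eqP eB]|[Q QB ->]].
    have cP := cover_partition pP.
    have Pb : pblock P x \in P by rewrite pblock_mem // cP.
    have eD : A :\: B = pblock P x.
      by rewrite -eB setDDr setDv set0U; apply/setIidPr/(partitionS pP).
    exists (P :\ (A :\: B)); last by rewrite setD1K // eD.
    by rewrite inE -{2}eB eD partitionD1.
  have pQ : partition Q B by move: QB; rewrite inE.
  have pP : partition ((A :\: B) |: Q) A.
    rewrite -{2}DB partitionU1 //; first by apply/set0Pn; exists x.
    by rewrite disjoint_sym disjoints_subset setCD subsetUr.
  split=> //.
  rewrite (def_pblock (partition_trivIset pP) _ xD) ?setU11 //.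
  by rewrite setDDr setDv set0U; apply/eqP/setIidPr.
move=> P; rewrite inE => pP; rewrite powersetE; apply/subsetP => y.
rewrite !inE => /andP[yP ->]; rewrite andbT; apply: contraNneq yP => ->.
by rewrite mem_pblock (cover_partition pP).
Qed.

End SetPartitions.

(** * Words avoiding 12-3 and their count *)

Section Words.

Variable n : nat.
Implicit Types (A B : {set 'I_n}) (x y z m : 'I_n) (u v w : seq 'I_n).

(* Vincular pattern 12-3: the letters playing 1 and 2 are adjacent.           *)
Fixpoint avoids_12_3 w : bool :=
  if w is x :: v then
    (if v is y :: r then (x < y) ==> all (fun z => z <= y) r else true)
      && avoids_12_3 v
  else true.

Lemma avoids_12_3Pn w :
  reflect (exists u x y r z,
    [/\ w = u ++ x :: y :: r, x < y, z \in r & y < z]) (~~ avoids_12_3 w).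
Proof.
apply: (iffP idP) => [|[u [x [y [r [z [-> xy zr yz]]]]]]]; last first.
  elim: u => [|a u IHu]; last by rewrite cat_cons /= negb_and IHu orbT.
  rewrite /= xy /=; apply/nandP; left; apply/allPn; exists z => //.
  by rewrite -ltnNge.
elim: w => //= x [//|y r] IHw; rewrite negb_and => /orP[|/IHw].
  rewrite negb_imply => /andP[xy /allPn[z zr]]; rewrite -ltnNge => yz.
  by exists [::], x, y, r, z.
by move=> [u [a [b [s [z [-> ? ? ?]]]]]]; exists (x :: u), a, b, s, z.
Qed.

(** An ascent inside [u] is completed by the later [m]; an ascent into [m] has nothing larger after
    it, and [m] starts no ascent. *)
Lemma avoids_12_3_cat_max u m v :
  all (fun x => x < m) u -> all (fun x => x < m) v ->
  avoids_12_3 (u ++ m :: v) = sorted (relpre val geq) u && avoids_12_3 v.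
Proof.
move=> + vm; elim: u => [_|x u IHu /= /andP[xm um]] /=.
  by case: v vm => //= y v /andP[ym _]; rewrite ltnNge ltnW.
rewrite IHu //; case: u um {IHu} => [_|y u /andP[ym _]] /=.
  rewrite xm /=; case: allP => //= -[z zv].
  by rewrite ltnW //; apply: (allP vm).
rewrite -andbA [x < y]ltnNge implyNb [y <= x]/(geq x y).
suff -> : all (fun z => z <= y) (u ++ m :: v) = false by rewrite orbF.
by apply/negbTE/allPn; exists m; rewrite ?mem_cat ?mem_head ?orbT // -ltnNge.
Qed.

Lemma rev_enum_sorted A : sorted (relpre val geq) (rev (enum A)).
Proof.
rewrite rev_sorted; apply: (@sub_sorted _ (relpre val ltn)).
  by move=> x y /ltnW.
rewrite {1}/enum_mem -enumT; apply: sorted_filter.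
  by move=> x y z; apply: ltn_trans.
by rewrite -sorted_map val_enum_ord iota_ltn_sorted.
Qed.

Definition words A : seq (seq 'I_n) :=
  [seq w <- permutations (enum A) | avoids_12_3 w].

Lemma mem_words A w : (w \in words A) = avoids_12_3 w && perm_eq w (enum A).
Proof. by rewrite mem_filter mem_permutations. Qed.

Lemma words_uniq A : uniq (words A).
Proof. by rewrite filter_uniq ?permutations_uniq. Qed.

(** A word determines its alphabet, so words over different sets never coincide when the sets are
    summed over. *)
Lemma words_set A w : w \in words A -> A = [set x in w].
Proof.
rewrite mem_words => /andP[_ p]; apply/setP => x.
by rewrite inE (perm_mem p) mem_enum.
Qed.

Lemma set_words w : uniq w -> avoids_12_3 w -> w \in words [set x in w].
Proof.
move=> uw aw; rewrite mem_words aw uniq_perm ?enum_uniq // => x.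
by rewrite mem_enum inE.
Qed.

Lemma size_words0 : size (words set0) = 1.
Proof. by rewrite /words enum_set0. Qed.

(* The part of a 12-3-avoiding word before its maximum m is decreasing, so    *)
(* the word is determined by what follows m.                                  *)
Lemma size_words_rec A m : m \in A -> (forall x, x \in A -> x <= m) ->
  size (words A) = \sum_(B in powerset (A :\ m)) size (words B).
Proof.
move=> mA mmax.
pose ext B v := rev (enum (A :\ m :\: B)) ++ m :: v.
have lt_m x : x \in A :\ m -> x < m.
  by rewrite !inE ltn_neqAle => /andP[-> /mmax].
have sub_m B w : B \in powerset (A :\ m) -> w \in words B ->
    {subset w <= A :\ m}.
  rewrite powersetE => /subsetP sB /words_set eB x xw; apply: sB.
  by rewrite eB inE.
suff /perm_size -> : perm_eq (words A)
    [seq ext B v | B <- enum (powerset (A :\ m)), v <- words B].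
  by rewrite size_allpairs_dep sumnE big_map big_enum.
apply: uniq_perm; first exact: words_uniq.
  apply: allpairs_uniq_dep; [exact: enum_uniq | move=> B _; exact: words_uniq |].
  move=> _ _ /allpairsPdep[B [v [_ vB ->]]] /allpairsPdep[C [w [_ wC ->]]] /=.
  (* The prefix omits [m], so cutting just after the first [m] recovers the suffix. *)
  have drop_ext D s : drop (index m (ext D s)).+1 (ext D s) = s.
    rewrite /ext index_cat mem_rev mem_enum !inE eqxx andbF /= eqxx addn0.
    by rewrite -cat_rcons drop_size_cat // size_rcons.
  move=> e; have evw : v = w by rewrite -(drop_ext B v) e drop_ext.
  by rewrite (words_set vB) (words_set wC) evw.
move=> w; rewrite mem_words; apply/andP/allpairsPdep => [[]|].
  move=> + pw; have uw : uniq w by rewrite (perm_uniq pw) enum_uniq.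
  have mw : m \in w by rewrite (perm_mem pw) mem_enum.
  case/splitPr: mw pw uw => u v pw uw.
  have [mu mv] : m \notin u /\ m \notin v.
    by move: uw; rewrite uniq_catC /= mem_cat => /andP[/norP[]].
  have in_w x : (x \in A) = [|| x \in u, x == m | x \in v].
    by rewrite -mem_enum -(perm_mem pw) mem_cat inE.
  have [um vm] : all (fun x : 'I_n => x < m) u /\ all (fun x : 'I_n => x < m) v.
    by split; apply/allP => x xuv; apply: lt_m; rewrite !inE in_w xuv ?orbT andbT;
      apply: contraTneq xuv => ->.
  rewrite avoids_12_3_cat_max // => /andP[su av].
  have uv : uniq v by move: uw; rewrite cat_uniq /= => /and4P[].
  exists [set x in v], v; split; last 1 first.
  - rewrite /ext; congr (_ ++ _).
    (* A decreasing word is determined by its letters. *)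
    apply: (@sorted_eq _ (relpre val geq)) su _ _.
    + by move=> x y z /= yx xz; apply: leq_trans xz yx.
    + by move=> x y /= xy; apply/val_inj/anti_leq; rewrite andbC.
    + exact: rev_enum_sorted.
    + rewrite uniq_perm ?rev_uniq ?enum_uniq //.
        by move: uw; rewrite cat_uniq => /and3P[].
      move=> x; rewrite mem_rev mem_enum !inE in_w.
      move: uw; rewrite cat_uniq => /and3P[_ /hasPn nu _].
      have := nu x; rewrite inE.
      by case: eqP => [->|_] /=; rewrite ?(negPf mu) ?(negPf mv) //;
        case: (x \in v) => /= [/(_ isT)/negPf->|]; rewrite ?orbF.
  - rewrite mem_enum powersetE; apply/subsetP => x; rewrite !inE in_w => xv.
    by rewrite xv !orbT andbT; apply: contraTneq xv => ->.
  - exact: set_words.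
case=> B [v []]; rewrite mem_enum => sB vB ->.
have := sB; rewrite powersetE => /subsetP sB'.
have := vB; rewrite mem_words => /andP[av pv].
split.
  rewrite avoids_12_3_cat_max ?av ?andbT.
  - exact: rev_enum_sorted.
  - by apply/allP => x; rewrite mem_rev mem_enum => /setDP[/lt_m].
  - by apply/allP => x /(sub_m _ _ sB vB)/lt_m.
rewrite /ext -cat_rcons; apply: uniq_perm; rewrite ?enum_uniq //.
  rewrite cat_uniq rcons_uniq rev_uniq enum_uniq (perm_uniq pv) enum_uniq.
  rewrite mem_rev mem_enum !inE eqxx andbF /= andbT.
  apply/hasPn => x; rewrite (perm_mem pv) mem_enum mem_rcons inE mem_rev.
  rewrite mem_enum => xB.
  by have := sB' _ xB; rewrite !inE xB /= orbF => /andP[->].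
move=> x; rewrite mem_cat mem_rcons inE mem_rev !mem_enum (perm_mem pv) mem_enum.
rewrite !inE.
have := sB' x; rewrite !inE.
by case: eqP => [->|_] /=;
  [rewrite mA | case: (x \in B) => //= [->|]; rewrite ?orbF].
Qed.

(** Strong induction on the size of [A]: both sides satisfy the same recurrence at the maximum of
    [A]. *)
Lemma size_words A : size (words A) = #|partitions A|.
Proof.
have [k] := ubnP #|A|; elim: k A => // k IHk A leAk.
have [->|[x0 x0A]] := set_0Vmem A; first by rewrite size_words0 card_partitions0.
pose m := [arg max_(y > x0 in A) (y : nat)].
have [mA mmax] : m \in A /\ forall x, x \in A -> x <= m.
  by rewrite /m; case: arg_maxnP => // i.
rewrite (size_words_rec mA mmax) (card_partitions_rec mA).
apply: eq_bigr => B; rewrite powersetE => /subset_leq_card leB.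
apply: IHk; rewrite (leq_ltn_trans leB) //.
by move: leAk; rewrite (cardsD1 m) mA.
Qed.

End Words.

(** * From pattern avoidance to the cycle of the maximum *)

Section Cycles.

Variable n : nat.
Implicit Types (s : 'S_n.+1) (x y z : 'I_n.+1) (v : seq 'I_n.+1).

Lemma orbit_ord_max s : orbit s ord_max = ord_max :: behead (orbit s ord_max).
Proof. by rewrite /orbit -orderSpred. Qed.

(** The maximum is the largest leader, so its cycle is listed last. *)
Lemma theta_word_ord_max s : exists u, theta_word s = u ++ orbit s ord_max.
Proof.
rewrite /theta_word /standard_cycle_form enum_ordSr filter_rcons.
have -> : cycle_leader s ord_max by apply/allP => y _; apply: leq_ord.
by rewrite map_rcons flatten_rcons; eexists.
Qed.

Lemma index_theta s i : index (theta s i) (theta_word s) = i.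
Proof.
by rewrite permE /theta_fun (tnth_nth i) index_uniq ?theta_word_uniq //
  (eqP (size_theta_word s)).
Qed.

Lemma letterK i : 0 < i <= 3 -> letter 2 i = i.-1 :> nat.
Proof. by case: i => // i lti; rewrite inordK. Qed.

Lemma contains_thetaP s :
  reflect (exists x y z, [/\ x < y, y < z, s x = y
             & index x (theta_word s) < index z (theta_word s)])
          (contains (theta s) pattern_13_1to2).
Proof.
apply: (iffP existsP) => [[x /existsP[t /and4P[ix it /forallP wx /forallP ax]]]|].
  exists (x (letter 2 1)), (x (letter 2 2)), (x (letter 2 3)); split.
  - move/forallP/(_ (letter 2 1))/forallP/(_ (letter 2 2))/implyP: ix; apply.
    by rewrite !letterK.
  - move/forallP/(_ (letter 2 2))/forallP/(_ (letter 2 3))/implyP: ix; apply.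
    by rewrite !letterK.
  - have := ax (letter 2 1) => /forallP/(_ (letter 2 2)).
    by rewrite /= inE eqxx hat_theta => /eqP.
  - have /eqP <- := wx ord0; have /eqP <- := wx ord_max.
    by rewrite !index_theta; move/forallP/(_ ord0)/forallP/(_ ord_max): it.
case=> x [y [z [xy yz sxy]]].
rewrite -{1}[x](permKV (theta s)) -{1}[z](permKV (theta s)) !index_theta => lt_t.
exists [ffun i : 'I_3 => nth x [:: x; y; z] i]; apply/existsP.
exists [ffun i : 'I_2 => nth x [:: (theta s)^-1%g x; (theta s)^-1%g z] i].
apply/and4P; split.
- apply/forallP => -[[|[|[|i]]] lti] //; apply/forallP => -[[|[|[|j]]] ltj] //;
    rewrite !ffunE //=; exact: ltn_trans yz.
- by apply/forallP => -[[|[|i]] lti] //; apply/forallP => -[[|[|j]] ltj] //;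
    rewrite !ffunE.
- apply/forallP => -[[|[|i]] lti] //; rewrite !ffunE /= permKV.
    by rewrite (tnth_nth (letter 2 1)) /= letterK.
  by rewrite (tnth_nth (letter 2 1)) /= letterK.
- apply/forallP => b; apply/forallP => c; apply/implyP; rewrite inE => /eqP[-> ->].
  by rewrite !ffunE !letterK //= hat_theta sxy.
Qed.

Definition fixed_off_max s : bool :=
  [forall x, (x \notin orbit s ord_max) ==> (s x == x)].

(* A nontrivial cycle avoiding the maximum m enters its largest element l     *)
(* from some x < l, and m lies to the right of x in theta s: x, l, m form the *)
(* pattern. When there is no such cycle, every ascent x < s x is realized by  *)
(* adjacent letters of the final segment orbit s m of theta s.                *)
Lemma contains_theta s : contains (theta s) pattern_13_1to2 =
  ~~ (fixed_off_max s && avoids_12_3 (behead (orbit s ord_max))).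
Proof.
set m := ord_max; have [u tw] := theta_word_ord_max s.
have uo : uniq (orbit s m) := orbit_uniq s m.
have oE := orbit_ord_max s; rewrite -/m in tw oE.
have u_orb x : (x \in u) = (x \notin orbit s m).
  have := theta_word_uniq s; have := mem_theta_word s x.
  rewrite tw mem_cat cat_uniq => xw /and3P[_ /hasPn disj _].
  case: (boolP (x \in orbit s m)) xw => [/disj/negbTE //|_].
  by rewrite orbF.
have index_orb x : x \in orbit s m ->
    index x (theta_word s) = size u + index x (orbit s m).
  by move=> xo; rewrite tw index_cat u_orb xo.
have index_u x : x \notin orbit s m -> index x (theta_word s) < size u.
  by move=> xo; rewrite tw index_cat u_orb xo index_mem u_orb.
apply/contains_thetaP/idP; last first.
  rewrite negb_and => /orP[|/avoids_12_3Pn].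
    move=> /forallPn[x0]; rewrite negb_imply => /andP[x0m sx0].
    pose l := [arg max_(y > x0 in orbit s x0) (y : nat)].
    have [lo lmax] : l \in orbit s x0 /\ forall y, y \in orbit s x0 -> y <= l.
      by rewrite /l; case: arg_maxnP; [exact: in_orbit | move=> i].
    have lm : l \notin orbit s m.
      apply: contra x0m; rewrite -!fconnect_orbit in lo * => mo.
      by apply: (connect_trans mo); rewrite (fconnect_sym perm_inj).
    pose x := (s^-1)%g l; have sx : s x = l by rewrite permKV.
    have xo : x \in orbit s x0.
      rewrite -!fconnect_orbit in lo *; apply: (connect_trans lo).
      by rewrite (fconnect_sym perm_inj) -sx fconnect1.
    have xm : x \notin orbit s m.
      by apply: contra lm => xm; rewrite -sx mem_orbit.
    exists x, l, m; split=> //.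
    (* If [x = l], then [l] is fixed and its cycle is trivial, contradicting that [s] moves [x0]. *)
    - rewrite ltn_neqAle lmax // andbT.
      apply: contra sx0 => /eqP/val_inj exl; rewrite exl in sx.
      have : x0 \in orbit s l.
        by rewrite -!fconnect_orbit in lo *; rewrite (fconnect_sym perm_inj).
      rewrite -fconnect_orbit => /iter_findex <-.
      by rewrite -iterS iterSr sx.
    - rewrite ltn_neqAle leq_ord andbT; apply: contra lm => /eqP e.
      by rewrite (_ : l = m) ?in_orbit //; apply: val_inj.
    - by rewrite (index_orb m) ?in_orbit // ltn_addr // index_u.
  case=> u' [x [y [r [z [ev xy zr yz]]]]].
  (* Adjacent letters [x], [y] of the orbit satisfy [s x = y], which supplies the arrow. *)
  have := cycle_orbit (@perm_inj _ s) m; rewrite oE ev -cat_cons in uo *.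
  move=> fc; have oE' : orbit s m = (m :: u') ++ x :: y :: r by rewrite oE ev.
  exists x, y, z; split=> //.
    by move: fc; rewrite cat_cons /= rcons_cat cat_path /= => /and3P[_ _ /andP[/eqP]].
  rewrite !index_orb ?oE' ?mem_cat ?inE ?eqxx ?zr ?orbT // ltn_add2l.
  move: uo; rewrite cat_uniq => /and3P[_ /hasPn disj uxr].
  rewrite !index_cat !ifN; [|by apply: disj; rewrite !inE zr !orbT
                            |by apply: disj; rewrite !inE eqxx].
  rewrite ltn_add2l /= eqxx ifN //.
  by apply: contraTneq uxr => ->; rewrite /= !inE zr orbT.
case=> x [y [z [xy yz sxy xz]]]; apply/negP => /andP[/forallP fix_s av].
have xo : x \in orbit s m.
  apply: contraTT xy => /(implyP (fix_s x))/eqP; rewrite sxy => ->.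
  by rewrite ltnn.
(* Letters off this orbit all lie in [u], to the left of [x]. *)
have zo : z \in orbit s m.
  apply: contraTT xz => /index_u; rewrite (index_orb x) // -leqNgt => lt_z.
  by rewrite (leq_trans (ltnW lt_z)) ?leq_addr.
have := xz; rewrite !index_orb // ltn_add2l => {}xz.
have xv : x \in behead (orbit s m).
  move: xo; rewrite oE inE => /orP[/eqP xm|//].
  by move: xy; rewrite xm ltnNge leq_ord.
have := cycle_orbit (@perm_inj _ s) m; rewrite oE in uo xz zo *.
case/splitPr: xv av xz zo uo => v r av xz zo uo fc.
(* If [x] closes the cycle, then [y = s x = m] and no [z] exceeds it; otherwise the letter after [x]
   is [y]. *)
case: r fc av xz zo uo => [|y' r] fc av xz zo uo.
  move: fc; rewrite cats1 /= rcons_path last_rcons /= sxy => /andP[_ /eqP ym].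
  by move: yz; rewrite ym ltnNge leq_ord.
have ey : y' = y.
  by move: fc; rewrite /= rcons_cat cat_path /= sxy => /and3P[_ _ /andP[/eqP]].
rewrite ey in av xz zo uo; move/avoids_12_3Pn: av; case.
exists v, x, y, r, z; split=> //.
move: uo xz; rewrite -cat_cons cat_uniq => /and3P[_ /hasPn disj _].
rewrite !index_cat (negPf (disj x _)) ?mem_head //=.
(* A [z] in [m :: v] would precede [x]; otherwise [z] is in [x :: y :: r], and its size excludes [x]
   and [y]. *)
rewrite eqxx addn0; case: ifP => [|zu _].
  by rewrite -index_mem => /ltnW; rewrite leqNgt => /negPf->.
move: zo; rewrite -cat_cons mem_cat zu /= !inE.
by case/or3P => // /eqP ez; move: xy yz; rewrite ez ?ltnn // => /ltn_trans h/h;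
  rewrite ltnn.
Qed.

Definition avoiding_cycles s : bool :=
  fixed_off_max s && avoids_12_3 (behead (orbit s ord_max)).

(** [next] fixes every point outside its list, so the orbit of the maximum determines [s]; this
    gives injectivity of the coding. *)
Lemma fixed_off_max_next s : fixed_off_max s -> s =1 next (orbit s ord_max).
Proof.
move=> /forallP fix_s x; case: (boolP (x \in orbit s ord_max)) => xo.
  by rewrite (nextE (cycle_orbit (@perm_inj _ s) _) xo).
by rewrite next_nth (negPf xo); apply/eqP/(implyP (fix_s x)).
Qed.

(** Gives surjectivity of the coding: the permutation with a prescribed cycle through the
    maximum. *)
Lemma orbit_cycle_perm v (uv : uniq (ord_max :: v)) :
  orbit (perm (can_inj (prev_next uv))) ord_max = ord_max :: v.
Proof.
have fc : fcycle (perm (can_inj (prev_next uv))) (ord_max :: v).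
  rewrite (eq_fcycle (f' := next (ord_max :: v))) ?cycle_next // => x.
  exact: permE.
by rewrite (orbitE fc uv) ?mem_head //= eqxx rot0.
Qed.

Lemma card_avoiding_cycles : #|[set s | avoiding_cycles s]| = #|partitions [set: 'I_n.+1]|.
Proof.
rewrite (card_partitions_rec (in_setT ord_max)).
pose tl s := behead (orbit s ord_max).
suff /perm_size e : perm_eq [seq tl s | s <- enum [set s | avoiding_cycles s]]
    [seq v | B <- enum (powerset ([set: 'I_n.+1] :\ ord_max)), v <- words B].
  rewrite cardE -(size_map tl) e size_allpairs_dep sumnE big_map big_enum.
  by apply: eq_bigr => B _; rewrite size_words.
apply: uniq_perm.
- rewrite map_inj_in_uniq ?enum_uniq // => s t.
  rewrite !mem_enum !inE => /andP[/fixed_off_max_next fs _].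
  case/andP=> /fixed_off_max_next ft _ est; apply/permP => x.
  by rewrite fs ft orbit_ord_max [orbit t _]orbit_ord_max [behead _]est.
- apply: allpairs_uniq_dep; [exact: enum_uniq | move=> B _; exact: words_uniq |].
  move=> _ _ /allpairsPdep[B [v [_ vB ->]]] /allpairsPdep[C [w [_ wC ->]]] /= evw.
  by rewrite (words_set vB) (words_set wC) evw.
move=> v; apply/mapP/allpairsPdep => [[s]|[B [w [+ + ->]]]].
  rewrite mem_enum inE => /andP[_ av] ->; exists [set x in tl s], (tl s).
  have := orbit_uniq s ord_max; rewrite orbit_ord_max /= => /andP[mv uv].
  split=> //; last exact: set_words.
  rewrite mem_enum powersetE; apply/subsetP => x; rewrite !inE andbT => xv.
  by apply: contraTneq xv => ->.
rewrite mem_enum powersetE => /subsetP sB wB.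
have := wB; rewrite mem_words => /andP[aw pw].
have uw : uniq (ord_max :: w).
  rewrite /= (perm_uniq pw) enum_uniq andbT (perm_mem pw) mem_enum.
  by apply/negP => /sB; rewrite !inE eqxx.
exists (perm (can_inj (prev_next uw))); last by rewrite /tl orbit_cycle_perm.
rewrite mem_enum inE /avoiding_cycles /fixed_off_max orbit_cycle_perm aw andbT.
apply/forallP => x; apply/implyP => xw.
by rewrite permE next_nth (negPf xw).
Qed.

End Cycles.

Theorem theorem5p1 : forall n : nat,
  1 <= n -> num_avoiders n pattern_13_1to2 = bell n.
Proof.
case=> // n _; rewrite /num_avoiders.
have thetaB : bijective (@theta n.+1).
  by exists (@hat _); [exact: hat_theta | exact: theta_hat].
(* Passes from the permutations [pi] to their preimages [s] under [theta]. *)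
rewrite -(on_card_preimset (onW_bij _ thetaB)).
transitivity #|[set s : 'S_n.+1 | avoiding_cycles s]|; last exact: card_avoiding_cycles.
by apply: eq_card => s; rewrite !inE contains_theta negbK.
Qed.
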